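(* Let $n\ge 0$ be an integer and let $a,b,q$ be complex numbers. (i) If none of the denominators appearing on either side of the following formula vanishes, then $$\det\left(\frac{(aq;q)_{j+k}}{(abq^{2};q)_{j+k}}\right)_{j,k=0}^{n}=a^{n(n+1)/2}\,q^{n(n+1)(2n+1)/6}\prod_{k=1}^{n}\frac{(q,aq,bq,abq;q)_{k}}{(abq,abq^{2},abq^{2},abq^{3};q^{2})_{k}}.$$ (ii) If $a\neq 0$, $q\ne 0$ and $q^{k}\neq 1$, $aq^{k}\neq 1$, $bq^{k}\neq 1$, $abq^{k}\neq 1$ for every integer $k\ge 1$, then the matrix $\left(\frac{(aq;q)_{j+k}}{(abq^{2};q)_{j+k}}\right)_{j,k=0}^{n}$ is invertible, and its inverse $(\gamma_{jk})_{j,k=0}^{n}$ has entries $$\gamma_{jk}=\frac{(-1)^{j+k}q^{[j(j+1)+k(k+1)]/2}}{(aq;q)_{j}(aq;q)_{k}}\sum_{m=\max(j,k)}^{n}\frac{(1-abq^{2m+1})(aq,abq;q)_{m}}{(1-abq)(q,bq;q)_{m}(aq^{j+k+1})^{m}}\left[\begin{array}{c}m\\ j\end{array}\right]_{q}\left[\begin{array}{c}m\\ k\end{array}\right]_{q}(abq^{m+1};q)_{j}(abq^{m+1};q)_{k}.$$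
   Context: For complex $x,p$ and an integer $m\ge 0$, $(x;p)_{m}:=\prod_{i=0}^{m-1}(1-xp^{i})$, with $(x;p)_0=1$. Also $(x_{1},\dots,x_{r};p)_{m}:=\prod_{i=1}^{r}(x_{i};p)_{m}$. For integers $0\le j\le m$, $\left[\begin{array}{c}m\\ j\end{array}\right]_{q}:=\frac{(q;q)_{m}}{(q;q)_{j}(q;q)_{m-j}}$. Matrices are indexed by $j,k=0,1,\dots,n$. *)

(* Defs.v *)
From HB Require Import structures.
From mathcomp Require Export all_boot all_order all_algebra.
From mathcomp Require Export reals.
From mathcomp Require Export complex.

Set Implicit Arguments.
Unset Strict Implicit.
Unset Printing Implicit Defensive.

Import GRing.Theory.

Local Open Scope ring_scope.

Definition qpoch (F : fieldType) (x p : F) (m : nat) : F :=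
  \prod_(i < m) (1 - x * p ^+ i).

Definition qpochs (F : fieldType) (s : seq F) (p : F) (m : nat) : F :=
  \prod_(x <- s) qpoch x p m.

(* Gaussian binomial coefficient; meaningful for j <= m. *)
Definition qbinom (F : fieldType) (q : F) (m j : nat) : F :=
  qpoch q q m / (qpoch q q j * qpoch q q (m - j)).

Definition qjacobi_hankel (F : fieldType) (n : nat) (a b q : F) : 'M[F]_n.+1 :=
  \matrix_(j, k) (qpoch (a * q) q (j + k) / qpoch (a * b * q ^+ 2) q (j + k)).

(* The halved exponent is an exact division, j(j+1) + k(k+1) being even. *)
Definition qjacobi_hankel_inv (F : fieldType) (n : nat) (a b q : F) :
    'M[F]_n.+1 :=
  \matrix_(j, k)
    ((-1) ^+ (j + k) * q ^+ ((j * (j + 1) + k * (k + 1)) %/ 2)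
       / (qpoch (a * q) q j * qpoch (a * q) q k)
     * \sum_(maxn j k <= m < n.+1)
         ((1 - a * b * q ^+ (2 * m + 1)) * qpochs [:: a * q; a * b * q] q m
            / ((1 - a * b * q) * qpochs [:: q; b * q] q m
               * (a * q ^+ (j + k + 1)) ^+ m)
          * qbinom q m j * qbinom q m k
          * qpoch (a * b * q ^+ (m + 1)) q j
          * qpoch (a * b * q ^+ (m + 1)) q k)).

(* Main.v *)
Require Import Defs.
From mathcomp Require Import zify ring.

Set Implicit Arguments.
Unset Strict Implicit.
Unset Printing Implicit Defensive.

Import GRing.Theory.
Local Open Scope ring_scope.

(** Write H for the Hankel matrix of the moments
    mu_i = (aq;q)_i / (abq^2;q)_i of the little q-Jacobi polynomials. Both
    parts follow from an explicit congruence L H L^T = diag(pivot_0, ...,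
    pivot_n) with L lower triangular ([qjacobi_orthogonality]); row m of L lists
    the coefficients of the m-th little q-Jacobi polynomial, rescaled so that
    nothing is divided by (aq;q)_j, by powers of q, or by (q;q)_j. Thanks to
    this scaling L makes sense, with diagonal (-1)^m (abq^(m+1);q)_m, under the
    bare assumption that the denominators in (i) do not vanish: q may be zero
    or a root of unity, and a or b may be zero. Taking determinants gives (i),
    and H^-1 = L^T diag(1/pivot) L, read entry by entry, gives (ii).

    By symmetry of H the congruence only requires the entries of L H on and
    below the diagonal, that is, the sums sum_j L_{mj} mu_{j+k} for k <= m.
    These are balanced 3phi2 series, so the q-Saalschuetz formula applies. Here
    it takes the following form. Let w_{m,j} be the coefficient of X^j in
    prod_{l<m} (q^l - X), and let T_m f = sum_j w_{m,j} f(q^j). Then T_m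
    annihilates polynomials of degree less than m, and for u_1, ..., u_m
      T_m (prod_i (1 - u_i x) / (1 - c x))
        = q^(m(m-1)/2) (q;q)_m prod_i (c - u_i) / (c;q)_{m+1}
    ([qdiff_rational]). In the sum above the u_i are
    aq, ..., aq^k, abq^(k+2), ..., abq^(m+1) and c = abq^(m+1); for k < m the
    number c is itself one of the u_i, hence the sum vanishes
    ([moment_sum], [moment_sum_eq0]). *)

(** * Shifted factorials *)

Section QPoch.
Variable F : fieldType.
Implicit Types (x p q c : F) (m k : nat).

Lemma qpoch0 x p : qpoch x p 0 = 1.
Proof. by rewrite /qpoch big_ord0. Qed.

Lemma qpochS x p m : qpoch x p m.+1 = qpoch x p m * (1 - x * p ^+ m).
Proof. by rewrite /qpoch big_ord_recr. Qed.

Lemma qpochD x p m k : qpoch x p (m + k) = qpoch x p m * qpoch (x * p ^+ m) p k.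
Proof.
elim: k => [|k IHk]; first by rewrite addn0 qpoch0 mulr1.
by rewrite addnS !qpochS IHk mulrA -(mulrA x) -exprD.
Qed.

Lemma qpochSl x p m : qpoch x p m.+1 = (1 - x) * qpoch (x * p) p m.
Proof. by rewrite -add1n qpochD qpochS qpoch0 mul1r expr0 mulr1 expr1. Qed.

Lemma qpoch_double x p m :
  qpoch x p (2 * m) = qpoch x (p ^+ 2) m * qpoch (x * p) (p ^+ 2) m.
Proof.
elim: m => [|m IHm]; first by rewrite muln0 !qpoch0 mulr1.
rewrite mulnS addnC addn2 !qpochS IHm -exprM (exprS p (2 * m)); ring.
Qed.

Lemma qpoch_neq0 x p m :
  (forall i, (i < m)%N -> 1 - x * p ^+ i != 0) -> qpoch x p m != 0.
Proof. by move=> h; apply/prodf_neq0 => i _; apply: h. Qed.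

Lemma qpoch_neq0P x p m i :
  qpoch x p m != 0 -> (i < m)%N -> 1 - x * p ^+ i != 0.
Proof. by move=> /prodf_neq0 h im; apply: (h (Ordinal im)). Qed.

End QPoch.

(** * An m-th order q-difference functional *)

Section QDiff.
Variables (F : fieldType) (q : F).
Implicit Types (c u : F) (m i j k : nat) (f g : nat -> F) (s : seq F).

(** Its coefficients are the signed q-binomials
    (-1)^j q^((m-j)(m-j-1)/2) [m, j]_q (see [coef_qdpoly]), but in a form that
    stays meaningful when q is zero or a root of unity. *)
Definition qdpoly m : {poly F} := \prod_(l < m) ((q ^+ l)%:P - 'X).

(** The argument [f] stands for j |-> F(q^j) where F is a function of x; this
    way nothing is lost when the powers of q are not distinct. *)
Definition qdiff m f : F := \sum_(j < m.+1) (qdpoly m)`_j * f j.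

Lemma qdpolyS m : qdpoly m.+1 = qdpoly m * ((q ^+ m)%:P - 'X).
Proof. by rewrite /qdpoly big_ord_recr. Qed.

Lemma coef_qdpolyS m j : (qdpoly m.+1)`_j
  = q ^+ m * (qdpoly m)`_j - (if j is j'.+1 then (qdpoly m)`_j' else 0).
Proof. by rewrite qdpolyS mulrBr coefB coefMC coefMX mulrC; case: j. Qed.

Lemma coef_qdpoly_gt m j : (m < j)%N -> (qdpoly m)`_j = 0.
Proof.
elim: m j => [|m IHm] [|j] // mj.
  by rewrite /qdpoly big_ord0 coef1.
by rewrite coef_qdpolyS !IHm ?mulr0 ?subr0 // ltnW.
Qed.

Lemma coef_qdpoly_diag m : (qdpoly m)`_m = (-1) ^+ m.
Proof.
elim: m => [|m IHm]; first by rewrite /qdpoly big_ord0 coef1.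
by rewrite coef_qdpolyS IHm coef_qdpoly_gt // mulr0 add0r exprS mulN1r.
Qed.

Lemma qdiff_widen m n f : (m <= n)%N ->
  \sum_(j < n.+1) (qdpoly m)`_j * f j = qdiff m f.
Proof.
move=> mn.
rewrite /qdiff [RHS](big_ord_widen n.+1 (fun j => (qdpoly m)`_j * f j)) //.
rewrite [RHS]big_mkcond /=; apply: eq_bigr => j _.
by rewrite ltnS; case: leqP => // /coef_qdpoly_gt ->; rewrite mul0r.
Qed.

Lemma eq_qdiff m f g :
  (forall j, (j <= m)%N -> f j = g j) -> qdiff m f = qdiff m g.
Proof. by move=> fg; rewrite /qdiff; apply: eq_bigr => j _; rewrite fg // -ltnS. Qed.

Lemma qdiffB m f g : qdiff m (fun j => f j - g j) = qdiff m f - qdiff m g.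
Proof. by rewrite /qdiff -sumrB; apply: eq_bigr => j _; rewrite mulrBr. Qed.

Lemma qdiffZ m c f : qdiff m (fun j => c * f j) = c * qdiff m f.
Proof. by rewrite /qdiff mulr_sumr; apply: eq_bigr => j _; rewrite mulrCA. Qed.

(** In terms of x: the functional of order m + 1 at F(x) is the one of order m at
    q^m F(x) - F(qx), so that evaluations go by induction on the order. *)
Lemma qdiffS m f :
  qdiff m.+1 f = q ^+ m * qdiff m f - qdiff m (fun j => f j.+1).
Proof.
rewrite {1}/qdiff; under eq_bigr do rewrite coef_qdpolyS mulrBl -mulrA.
rewrite sumrB -mulr_sumr qdiff_widen //; congr (_ - _).
by rewrite big_ord_recl /= mul0r add0r.
Qed.

Lemma qdiff_exp m i :
  qdiff m (fun j => q ^+ (i * j)) = \prod_(l < m) (q ^+ l - q ^+ i).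
Proof.
elim: m => [|m IHm].
  by rewrite /qdiff big_ord1 /qdpoly !big_ord0 coef1 muln0 expr0 mulr1.
rewrite qdiffS.
under [X in _ - X]eq_qdiff do rewrite mulnS exprD.
by rewrite qdiffZ IHm -mulrBl big_ord_recr mulrC.
Qed.

(** The value of the functional at x^m, see [qdiff_exp_diag]. *)
Definition qdconst m : F := q ^+ 'C(m, 2) * qpoch q q m.

Lemma qdconstS m : qdconst m.+1 = q ^+ m * (1 - q ^+ m.+1) * qdconst m.
Proof. rewrite /qdconst binS bin1 exprD qpochS -exprS; ring. Qed.

Lemma qdiff_exp_lt m i : (i < m)%N -> qdiff m (fun j => q ^+ (i * j)) = 0.
Proof. by move=> im; rewrite qdiff_exp (bigD1 (Ordinal im)) //= subrr mul0r. Qed.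

Lemma qdiff_exp_diag m : qdiff m (fun j => q ^+ (m * j)) = qdconst m.
Proof.
rewrite qdiff_exp /qdconst /qpoch.
under eq_bigr => l _.
  rewrite -{2}(subnKC (ltnW (ltn_ord l))) exprD -{1}[_ ^+ l]mulr1 -mulrBr.
  over.
rewrite big_split prodrXr -triangular_sum big_mkord; congr (_ * _).
rewrite (reindex_inj rev_ord_inj) /=; apply: eq_bigr => l _.
by rewrite subKn // exprS.
Qed.

(** Induction on m for all c at once: q^m/(1-cx) - 1/(1-cqx) is a combination
    of the functions for c and cq, and
    q^m (1 - cq^(m+1)) - q^m (1 - c) = c q^m (1 - q^(m+1)). *)
Lemma qdiff_inv m c : (forall j, (j <= m)%N -> 1 - c * q ^+ j != 0) ->
  qdiff m (fun j => (1 - c * q ^+ j)^-1)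
    = c ^+ m * qdconst m / qpoch c q m.+1.
Proof.
elim: m c => [|m IHm] c hc.
  rewrite /qdiff big_ord1 /qdpoly big_ord0 coef1 /qdconst qpochS !qpoch0.
  by rewrite !expr0 !mulr1 !mul1r.
rewrite qdiffS IHm; last by move=> j jm; apply: hc; lia.
under [X in _ - X]eq_qdiff do rewrite exprS mulrA.
rewrite IHm; last by move=> j jm; rewrite -mulrA -exprS; apply: hc; lia.
have h0 : 1 - c != 0 by have := hc 0%N isT; rewrite expr0 mulr1.
have h1 : 1 - c * q ^+ m.+1 != 0 by apply: hc.
have h2 : qpoch (c * q) q m != 0.
  by apply: qpoch_neq0 => i im; rewrite -mulrA -exprS; apply: hc; lia.
rewrite qdconstS (qpochSl c q m.+1) (qpochSl c q m) (qpochS (c * q)).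
rewrite -(mulrA c q) -exprS exprMn (exprS c).
by field; rewrite h0 h2 h1.
Qed.

(** From c x^(i+1)/(1-cx) = x^i/(1-cx) - x^i, since the last term is killed for
    i < m. Dividing by c forces a separate treatment of c = 0, where the
    function is the monomial x^i. *)
Lemma qdiff_exp_inv m i c : (i <= m)%N ->
  (forall j, (j <= m)%N -> 1 - c * q ^+ j != 0) ->
  qdiff m (fun j => q ^+ (i * j) / (1 - c * q ^+ j))
    = c ^+ (m - i) * qdconst m / qpoch c q m.+1.
Proof.
move=> im hc; have [c0|c0] := eqVneq c 0.
  have -> : qpoch c q m.+1 = 1.
    by rewrite /qpoch big1 // => l _; rewrite c0 mul0r subr0.
  rewrite (@eq_qdiff m _ (fun j => q ^+ (i * j))); last first.
    by move=> j _; rewrite c0 mul0r subr0 divr1.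
  rewrite divr1 c0; have [lt_im|] := ltnP i m.
    by rewrite qdiff_exp_lt // expr0n subn_eq0 leqNgt lt_im mul0r.
  move=> mi; have -> : i = m by lia.
  by rewrite subnn mul1r qdiff_exp_diag.
elim: i im => [|i IHi] im.
  rewrite subn0 -qdiff_inv //; apply: eq_qdiff => j _.
  by rewrite mul0n mul1r.
apply: (mulfI c0).
have e : (m - i = (m - i.+1).+1)%N by lia.
have {}IHi := IHi (ltnW im).
transitivity (c ^+ (m - i) * qdconst m / qpoch c q m.+1); last first.
  by rewrite e exprS !mulrA.
rewrite -IHi -qdiffZ.
rewrite -[RHS]subr0 -(qdiff_exp_lt im) -qdiffB.
apply: eq_qdiff => j jm; have h := hc j jm.
by rewrite mulSn exprD; field.
Qed.

(** A form of the q-Saalschuetz summation. The auxiliary power x^i makes an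
    induction on [s] possible: the factor 1 - ux splits the left side into the
    terms for i and i+1, whose values differ by a factor c, hence combine to
    c - u. *)
Lemma qdiff_rational m i s c : (i + size s <= m)%N ->
  (forall j, (j <= m)%N -> 1 - c * q ^+ j != 0) ->
  qdiff m (fun j => q ^+ (i * j) * (\prod_(u <- s) (1 - u * q ^+ j))
                      / (1 - c * q ^+ j))
    = c ^+ (m - (i + size s)) * \prod_(u <- s) (c - u)
        * qdconst m / qpoch c q m.+1.
Proof.
move=> + hc; elim: s i => [|u s IHs] i /= ism.
  rewrite big_nil mulr1 addn0 -qdiff_exp_inv //; last by lia.
  by apply: eq_qdiff => j _; rewrite big_nil mulr1.
transitivity (qdiff m (fun j => q ^+ (i * j) * (\prod_(u <- s) (1 - u * q ^+ j))
                      / (1 - c * q ^+ j))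
  - u * qdiff m (fun j => q ^+ (i.+1 * j) * (\prod_(u <- s) (1 - u * q ^+ j))
                      / (1 - c * q ^+ j))).
  rewrite -qdiffZ -qdiffB; apply: eq_qdiff => j _.
  rewrite big_cons mulSn exprD; ring.
rewrite !IHs; [|lia|lia].
have -> : (m - (i + size s) = (m - (i + (size s).+1)).+1)%N by lia.
have -> : (m - (i.+1 + size s) = m - (i + (size s).+1))%N by lia.
rewrite big_cons exprS; ring.
Qed.

(** The q-binomial theorem; the recursion for the coefficients is the q-Pascal
    rule. *)
Lemma coef_qdpoly m j : (forall k, q ^+ k.+1 != 1) -> (j <= m)%N ->
  (qdpoly m)`_j = (-1) ^+ j * q ^+ 'C(m - j, 2) * qbinom q m j.
Proof.
move=> hq; have hp k : qpoch q q k != 0.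
  by apply: qpoch_neq0 => i _; rewrite -exprS subr_eq0 eq_sym.
elim: m j => [|m IHm] j.
  rewrite leqn0 => /eqP ->; rewrite coef_qdpoly_diag /qbinom qpoch0.
  by rewrite subnn bin0n !expr0 !mul1r invr1.
rewrite coef_qdpolyS; case: j => [|j] jm.
  rewrite IHm // !subn0 subr0 binS bin1 exprD /qbinom !subn0 qpoch0 !mul1r.
  by rewrite !divff //; ring.
have [lt_jm|] := ltnP j m; last first.
  move=> mj; have -> : j = m by apply/eqP; rewrite eqn_leq -ltnS jm mj.
  rewrite coef_qdpoly_gt // mulr0 coef_qdpoly_diag subnn /qbinom subnn qpoch0.
  by rewrite exprS mulr1 divff // !mulr1 sub0r mulN1r.
rewrite !IHm //.
have e : (m - j = (m - j.+1).+1)%N by lia.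
rewrite subSS e binS bin1 exprD /qbinom subSS e.
set k := (m - j.+1)%N.
have em : m = (j + k.+1)%N by rewrite /k; lia.
have h1' : 1 - q * q ^+ j != 0 by rewrite -exprS subr_eq0 eq_sym.
have h2' : 1 - q * q ^+ k != 0 by rewrite -exprS subr_eq0 eq_sym.
rewrite !qpochS; have := hp j; have := hp k.
move: (qpoch q q m) (qpoch q q j) (qpoch q q k) => x y z z0 y0.
rewrite em addnS !exprS exprD.
by field; rewrite y0 z0 h1' h2'.
Qed.

End QDiff.

(** * Little q-Jacobi polynomials and their moments *)

Section Hankel.
Variables (F : fieldType) (a b q : F).

Local Notation C m j :=
  ((qdpoly q m)`_j * qpoch (a * b * q ^+ m.+1) q j
     * qpoch (a * q ^+ j.+1) q (m - j)).
Local Notation mu i := (qpoch (a * q) q i / qpoch (a * b * q ^+ 2) q i).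

Lemma prod_qpoch (x y : F) k :
  \prod_(u <- [seq x * q ^+ l | l <- index_iota 0 k]) (1 - u * y)
    = qpoch (x * y) q k.
Proof.
rewrite big_map big_mkord /qpoch; apply: eq_bigr => l _.
by rewrite mulrAC.
Qed.

(** For k <= m the quotient of shifted factorials is, as a function of x = q^j,
    a constant times a product of m linear factors divided by
    1 - abq^(m+1) x. *)
Lemma moment_sum m k : (k <= m)%N ->
  (forall i, (i <= 2 * m)%N -> 1 - a * b * q ^+ i.+1 != 0) ->
  \sum_(j < m.+1) C m j * mu (j + k)
    = qpoch (a * q) q m * (1 - a * b * q) * qdconst q m
      * (\prod_(l < k) (a * b * q ^+ m.+1 - a * q ^+ l.+1))
      * (\prod_(l < m - k) (a * b * q ^+ m.+1 - a * b * q ^+ (k + l).+2))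
      / qpoch (a * b * q) q (2 * m).+1.
Proof.
move=> km hd; set c := a * b * q ^+ m.+1.
pose s := [seq a * q * q ^+ l | l <- index_iota 0 k]
       ++ [seq a * b * q ^+ k.+2 * q ^+ l | l <- index_iota 0 (m - k)].
have ss : size s = m by rewrite size_cat !size_map !size_iota; lia.
have hc j : (j <= m)%N -> 1 - c * q ^+ j != 0.
  by move=> jm; rewrite /c -mulrA -exprD addSn; apply: hd; lia.
have hp x r : (x + r <= (2 * m).+1)%N -> qpoch (a * b * q ^+ x.+1) q r != 0.
  move=> xr; apply: qpoch_neq0 => i ir.
  by rewrite -mulrA -exprD addSn; apply: hd; lia.
have hp1 r : (r <= (2 * m).+1)%N -> qpoch (a * b * q) q r != 0.
  by move=> rm; have := hp 0%N r rm; rewrite expr1.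
have h0 : qpoch (a * b * q) q m != 0 by apply: hp1; lia.
have h1 : qpoch c q m.+1 != 0 by apply: hp; lia.
transitivity (qpoch (a * q) q m * (1 - a * b * q) / qpoch (a * b * q) q m *
   qdiff q m (fun j => q ^+ (0 * j) * \prod_(u <- s) (1 - u * q ^+ j)
      / (1 - c * q ^+ j))).
  rewrite -qdiffZ; apply: eq_bigr => j _; have jm : (j <= m)%N by rewrite -ltnS.
  rewrite mul0n mul1r big_cat !prod_qpoch /=.
  (* Up to factors free of j, e1 accounts for the linear factors with
     u = aq, ..., aq^k, and e2 for those with u = abq^(k+2), ..., abq^(m+1)
     and for the denominator. *)
  have e1 : qpoch (a * q ^+ j.+1) q (m - j) * qpoch (a * q) q (j + k)
          = qpoch (a * q) q m * qpoch (a * q * q ^+ j) q k.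
    have -> : qpoch (a * q) q m
            = qpoch (a * q) q j * qpoch (a * q * q ^+ j) q (m - j).
      by rewrite -qpochD subnKC.
    rewrite qpochD exprS (mulrA a); ring.
  have e2 : qpoch (a * b * q ^+ 2) q (j + k)
      * qpoch (a * b * q ^+ k.+2 * q ^+ j) q (m - k)
      * (1 - a * b * q)
      = qpoch (a * b * q) q m * qpoch c q j * (1 - c * q ^+ j).
    have -> : a * b * q ^+ k.+2 * q ^+ j = a * b * q ^+ 2 * q ^+ (j + k).
      by rewrite -2!(mulrA (a * b)) -!exprD; congr (_ * _ ^+ _); lia.
    rewrite -qpochD mulrC.
    have -> : a * b * q ^+ 2 = a * b * q * q by rewrite expr2 mulrA.
    rewrite -qpochSl.
    have -> : c = a * b * q * q ^+ m by rewrite -[RHS]mulrA -exprS.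
    by rewrite -[RHS]mulrA -qpochS -qpochD; congr qpoch; lia.
  have h2 := hc j jm.
  have h3 : qpoch (a * b * q ^+ 2) q (j + k) != 0 by apply: hp; lia.
  have eC : qpoch c q j = qpoch (a * b * q ^+ 2) q (j + k)
      * qpoch (a * b * q ^+ k.+2 * q ^+ j) q (m - k)
      * (1 - a * b * q) / (qpoch (a * b * q) q m * (1 - c * q ^+ j)).
    by rewrite e2; field; rewrite h2 h0.
  rewrite [LHS]mulrA -[X in X / _ = _]mulrA e1 eC.
  by field; rewrite h0 h2 h3.
rewrite qdiff_rational ?ss // add0n subnn expr0 mul1r.
have -> : (2 * m).+1 = (m + m.+1)%N by lia.
rewrite qpochD -[_ * q * q ^+ m]mulrA -exprS -/c big_cat !big_map !big_mkord /=.
under [X in _ * (X * _ * _ / _)]eq_bigr do rewrite -(mulrA a) -exprS.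
under [X in _ * (_ * X * _ / _)]eq_bigr do rewrite -(mulrA (a * b)) -exprD.
by field; rewrite h0 h1.
Qed.

Lemma moment_sum_eq0 m k : (k < m)%N ->
  (forall i, (i <= 2 * m)%N -> 1 - a * b * q ^+ i.+1 != 0) ->
  \sum_(j < m.+1) C m j * mu (j + k) = 0.
Proof.
move=> km hd; rewrite moment_sum // 1?ltnW //.
have lk : (m - k.+1 < m - k)%N by lia.
(* This factor is c - u for the last u, which equals c. *)
rewrite [X in _ * X / _](bigD1 (Ordinal lk)) //=.
have -> : (k + (m - k.+1)).+2 = m.+1 by lia.
by rewrite subrr mul0r mulr0 mul0r.
Qed.

(** Each factor is -a q^(l+1) (1 - b q^(m-l)). *)
Lemma prod_shift_sub m :
  \prod_(l < m) (a * b * q ^+ m.+1 - a * q ^+ l.+1)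
    = (- a) ^+ m * q ^+ 'C(m.+1, 2) * qpoch (b * q) q m.
Proof.
rewrite -triangular_sum big_mkord big_ord_recl add0n -prodrXr.
rewrite -[m in (- a) ^+ m]card_ord -prodr_const -big_split /=.
rewrite /qpoch [X in _ = _ * X](reindex_inj rev_ord_inj) -big_split /=.
apply: eq_bigr => l _.
have -> : m.+1 = (l.+1 + (m - l.+1).+1)%N by have := ltn_ord l; lia.
rewrite /bump /= add1n exprD (exprS q (m - l.+1)).
ring.
Qed.

(** The squared norm of the m-th rescaled polynomial for the moment
    functional. *)
Definition pivot m : F :=
  a ^+ m * q ^+ (m ^ 2) * qpoch q q m * qpoch (a * q) q m * qpoch (b * q) q m
  * qpoch (a * b * q ^+ m.+1) q m / qpoch (a * b * q ^+ 2) q (2 * m).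

Lemma moment_sum_diag m :
  (forall i, (i <= 2 * m)%N -> 1 - a * b * q ^+ i.+1 != 0) ->
  (\sum_(j < m.+1) C m j * mu (j + m)) * C m m = pivot m.
Proof.
move=> hd; rewrite moment_sum // subnn qpoch0 big_ord0 !mulr1.
rewrite prod_shift_sub coef_qdpoly_diag qpochSl /qdconst /pivot.
have h0 : 1 - a * b * q != 0 by have := hd 0%N isT; rewrite expr1.
have h1 : qpoch (a * b * q * q) q (2 * m) != 0.
  apply: qpoch_neq0 => i im.
  by rewrite -[a * b * q * q]mulrA -expr2 -mulrA -exprD; apply: hd.
have -> : a * b * q ^+ 2 = a * b * q * q by rewrite expr2 mulrA.
have -> : (m ^ 2 = 'C(m, 2) + 'C(m.+1, 2))%N.
  rewrite binS bin1; have := mul_bin_diag m 1; rewrite !bin1.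
  by case: (m) => [|m'] /=; nia.
rewrite exprD [(- a) ^+ m]exprNn.
(* One sign comes from the powers of -a, the other from the diagonal
   coefficient. *)
have e : (-1) ^+ m * (-1) ^+ m = 1 :> F by rewrite -expr2 sqrr_sign.
move: ((-1) ^+ m) e => e e1.
transitivity (e * e * (a ^+ m * (q ^+ 'C(m, 2) * q ^+ 'C(m.+1, 2))
  * qpoch q q m * qpoch (a * q) q m * qpoch (b * q) q m
  * qpoch (a * b * q ^+ m.+1) q m / qpoch (a * b * q * q) q (2 * m))).
  by field; rewrite h0 h1.
by rewrite e1 mul1r.
Qed.

Definition qjacobi_mx n : 'M[F]_n.+1 := \matrix_(m, j) C m j.

Lemma qjacobi_mx_trig n : is_trig_mx (qjacobi_mx n).
Proof.
by apply/is_trig_mxP => i j ij; rewrite mxE coef_qdpoly_gt // !mul0r.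
Qed.

Lemma tr_qjacobi_hankel n : (qjacobi_hankel n a b q)^T = qjacobi_hankel n a b q.
Proof. by apply/matrixP => i j; rewrite !mxE addnC. Qed.

Lemma qjacobi_mx_hankelE n (m k : 'I_n.+1) :
  (qjacobi_mx n *m qjacobi_hankel n a b q) m k
    = \sum_(j < m.+1) C m j * mu (j + k).
Proof.
rewrite mxE.
transitivity (\sum_(j < n.+1) (qdpoly q m)`_j *
  (qpoch (a * b * q ^+ m.+1) q j * qpoch (a * q ^+ j.+1) q (m - j) * mu (j + k))).
  by apply: eq_bigr => j _; rewrite !mxE !mulrA.
rewrite (qdiff_widen q (fun j => qpoch (a * b * q ^+ m.+1) q j
  * qpoch (a * q ^+ j.+1) q (m - j) * mu (j + k))); last by rewrite -ltnS.
by apply: eq_bigr => j _; rewrite !mulrA.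
Qed.

(** L H is upper triangular by [moment_sum_eq0] and so is L^T; the product is
    symmetric, hence diagonal. *)
Lemma qjacobi_orthogonality n :
  (forall i, (i <= 2 * n)%N -> 1 - a * b * q ^+ i.+1 != 0) ->
  qjacobi_mx n *m qjacobi_hankel n a b q *m (qjacobi_mx n)^T
    = diag_mx (\row_m pivot m).
Proof.
move=> hd; set P := LHS.
have hm (m : 'I_n.+1) i : (i <= 2 * m)%N -> 1 - a * b * q ^+ i.+1 != 0.
  by move=> im; apply: hd; have := ltn_ord m; lia.
have Psym : P^T = P by rewrite /P !trmx_mul trmxK tr_qjacobi_hankel mulmxA.
have Plow (i m : 'I_n.+1) : (i < m)%N -> P m i = 0.
  move=> im; rewrite mxE big1 // => k _.
  rewrite qjacobi_mx_hankelE; have [km|mk] := ltnP k m.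
    by rewrite moment_sum_eq0 ?mul0r //; apply: hm.
  by rewrite !mxE coef_qdpoly_gt ?mul0r ?mulr0 //; lia.
apply/matrixP => m i; rewrite [RHS]mxE [X in X *+ _]mxE.
have [<-|/eqP] := eqVneq m i; last first.
  move=> mi; rewrite mulr0n; have [im|mi'|/val_inj e] := ltngtP i m.
  - exact: Plow.
  - by rewrite -Psym mxE; apply: Plow.
  - by rewrite e in mi.
rewrite mulr1n /P mxE (bigD1 m) //= big1 => [|k km].
  rewrite addr0 qjacobi_mx_hankelE !mxE; apply: moment_sum_diag; exact: hm.
rewrite qjacobi_mx_hankelE; have [lt_km|mk|/val_inj e] := ltngtP k m.
- by rewrite moment_sum_eq0 ?mul0r //; apply: hm.
- by rewrite !mxE coef_qdpoly_gt ?mul0r ?mulr0.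
- by rewrite e eqxx in km.
Qed.

Lemma det_qjacobi_mx n :
  \det (qjacobi_mx n)
    = \prod_(m < n.+1) ((-1) ^+ m * qpoch (a * b * q ^+ m.+1) q m).
Proof.
rewrite det_trig ?qjacobi_mx_trig //; apply: eq_bigr => m _.
by rewrite mxE subnn qpoch0 mulr1 coef_qdpoly_diag.
Qed.

Lemma det_qjacobi_hankel n :
  (forall i, (i <= 2 * n)%N -> 1 - a * b * q ^+ i.+1 != 0) ->
  \det (qjacobi_hankel n a b q)
    = \prod_(m < n.+1) (pivot m / qpoch (a * b * q ^+ m.+1) q m ^+ 2).
Proof.
move=> hd; have hp (m : 'I_n.+1) : qpoch (a * b * q ^+ m.+1) q m != 0.
  apply: qpoch_neq0 => i im; rewrite -mulrA -exprD addSn; apply: hd.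
  by have := ltn_ord m; lia.
have d0 : \det (qjacobi_mx n) != 0.
  rewrite det_qjacobi_mx; apply/prodf_neq0 => m _.
  by rewrite mulf_neq0 ?signr_eq0.
apply: (mulfI d0); apply: (mulIf d0).
rewrite -[X in _ * X = _]det_tr -!det_mulmx qjacobi_orthogonality // det_diag.
rewrite mulrAC det_qjacobi_mx -!big_split /=; apply: eq_bigr => m _.
have h := hp m; rewrite mxE [X in _ = X * _]mulrACA -expr2 sqrr_sign mul1r -expr2.
by rewrite mulrC divfK // expf_neq0.
Qed.


(** Merging the bases: (abq, abq^2; q^2)_m = (abq;q)_{2m} and
    (abq^2, abq^3; q^2)_m = (abq^2;q)_{2m}. *)
Lemma pivot_det_term m :
  (forall i, (i <= 2 * m)%N -> 1 - a * b * q ^+ i.+1 != 0) ->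
  pivot m / qpoch (a * b * q ^+ m.+1) q m ^+ 2
    = a ^+ m * q ^+ (m ^ 2)
      * (qpochs [:: q; a * q; b * q; a * b * q] q m
         / qpochs [:: a * b * q; a * b * q ^+ 2; a * b * q ^+ 2;
                      a * b * q ^+ 3] (q ^+ 2) m).
Proof.
move=> hd; rewrite /pivot /qpochs !big_cons !big_nil !mulr1.
have hp x r : (x + r <= (2 * m).+1)%N -> qpoch (a * b * q ^+ x.+1) q r != 0.
  move=> xr; apply: qpoch_neq0 => i ir.
  by rewrite -mulrA -exprD addSn; apply: hd; lia.
have h1 : qpoch (a * b * q ^+ 2) q (2 * m) != 0 by apply: hp; lia.
have h2 : qpoch (a * b * q ^+ m.+1) q m != 0 by apply: hp; lia.
have h3 : qpoch (a * b * q) q m != 0.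
  by rewrite -[X in _ * X]expr1; apply: hp; lia.
have e1 := qpoch_double (a * b * q ^+ 2) q m.
have e2 := qpoch_double (a * b * q) q m.
rewrite -[a * b * q ^+ 2 * q]mulrA -exprSr in e1.
rewrite -[a * b * q * q]mulrA -expr2 mul2n -addnn qpochD in e2.
rewrite -[_ * q * q ^+ m]mulrA -exprS in e2.
have -> (x y z : F) : x * (y * (y * z)) = (x * y) * (y * z) by ring.
by rewrite -e1 -e2; field; rewrite h1 h2 h3.
Qed.

Lemma sumn_exponents n :
  (\sum_(1 <= k < n.+1) k = (n * (n + 1)) %/ 2)%N /\
  (\sum_(1 <= k < n.+1) k ^ 2 = (n * (n + 1) * (2 * n + 1)) %/ 6)%N.
Proof.
have [e1 e2] : (\sum_(1 <= k < n.+1) k * 2 = n * (n + 1))%N /\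
  (\sum_(1 <= k < n.+1) k ^ 2 * 6 = n * (n + 1) * (2 * n + 1))%N.
  rewrite -!big_distrl /=.
  elim: n => [|n [IH1 IH2]]; first by rewrite !big_geq.
  by split; rewrite big_nat_recr //= mulnDl ?IH1 ?IH2; nia.
by split; rewrite -?e2 -?e1 -big_distrl /= mulnK.
Qed.

(** * Determinant and inverse *)

Lemma det_qjacobi_hankelE n :
  (forall i, (i <= 2 * n)%N -> 1 - a * b * q ^+ i.+1 != 0) ->
  \det (qjacobi_hankel n a b q) =
     a ^+ ((n * (n + 1)) %/ 2) * q ^+ ((n * (n + 1) * (2 * n + 1)) %/ 6)
     * \prod_(1 <= k < n.+1)
         (qpochs [:: q; a * q; b * q; a * b * q] q k
          / qpochs [:: a * b * q; a * b * q ^+ 2; a * b * q ^+ 2;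
                       a * b * q ^+ 3] (q ^+ 2) k).
Proof.
move=> hd; have [<- <-] := sumn_exponents n.
rewrite -!prodrXr -!big_split det_qjacobi_hankel //=.
rewrite -(big_mkord xpredT (fun m => pivot m / qpoch (a * b * q ^+ m.+1) q m ^+ 2)).
rewrite big_ltn // [X in X * _ = _](_ : _ = 1) ?mul1r; last first.
  by rewrite /pivot muln0 !qpoch0 exp0n // !expr0 expr1n invr1 !mulr1.
apply: eq_big_nat => m /andP[_ mn]; apply: pivot_det_term => i im.
by apply: hd; lia.
Qed.

Lemma invmx_qjacobi_hankel n :
  (forall i, (i <= 2 * n)%N -> 1 - a * b * q ^+ i.+1 != 0) ->
  (forall m, (m <= n)%N -> pivot m != 0) ->
  qjacobi_hankel n a b q \in unitmx /\
  invmx (qjacobi_hankel n a b q)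
    = (qjacobi_mx n)^T *m diag_mx (\row_m (pivot m)^-1) *m qjacobi_mx n.
Proof.
move=> hd hp; set H := qjacobi_hankel _ _ _ _; set L := qjacobi_mx n.
set G := RHS; have HG : H *m G = 1%:M.
  rewrite /G !mulmxA; apply: mulmx1C; rewrite !mulmxA qjacobi_orthogonality //.
  rewrite mulmx_diag -diag_const_mx; congr diag_mx.
  by apply/rowP => m; rewrite !mxE divff // hp // -ltnS.
have [Hu _] := mulmx1_unit HG; split=> //.
by rewrite -[LHS]mulmx1 -HG mulKmx.
Qed.

(** In row m of L, (aq^(j+1);q)_{m-j} = (aq;q)_m / (aq;q)_j and the q-binomial
    theorem recover the summand of (ii), the entry being
    sum_m L_{mj} L_{mk} / pivot_m; the powers of q agree because
    m(m-1)/2 - mj + j(j+1)/2 = (m-j)(m-j-1)/2. *)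
Lemma invmx_qjacobi_hankelE n : a != 0 -> q != 0 ->
  (forall k : nat, (1 <= k)%N ->
     [/\ q ^+ k != 1, a * q ^+ k != 1, b * q ^+ k != 1
       & a * b * q ^+ k != 1]) ->
  qjacobi_hankel n a b q \in unitmx /\
  invmx (qjacobi_hankel n a b q) = qjacobi_hankel_inv n a b q.
Proof.
move=> a0 q0 hk.
have hd i : 1 - a * b * q ^+ i.+1 != 0.
  by have [_ _ _ h] := hk i.+1 isT; rewrite subr_eq0 eq_sym.
have hab x r : qpoch (a * b * q ^+ x.+1) q r != 0.
  by apply: qpoch_neq0 => i _; rewrite -mulrA -exprD addSn; apply: hd.
have hab1 r : qpoch (a * b * q) q r != 0 by have := hab 0%N r; rewrite expr1.
have hq1 k : q ^+ k.+1 != 1 by have [] := hk k.+1 isT.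
have hq r : qpoch q q r != 0.
  by apply: qpoch_neq0 => i _; rewrite -exprS subr_eq0 eq_sym.
have haq r : qpoch (a * q) q r != 0.
  apply: qpoch_neq0 => i _; rewrite -mulrA -exprS subr_eq0 eq_sym.
  by have [] := hk i.+1 isT.
have hbq r : qpoch (b * q) q r != 0.
  apply: qpoch_neq0 => i _; rewrite -mulrA -exprS subr_eq0 eq_sym.
  by have [] := hk i.+1 isT.
have hpiv m : pivot m != 0.
  by rewrite /pivot !mulf_neq0 ?invr_eq0 ?expf_neq0.
have [Hu ->] := @invmx_qjacobi_hankel n (fun i _ => hd i) (fun m _ => hpiv m).
split=> //; apply/matrixP => j k; rewrite !mxE big_geq_mkord mulr_sumr.
rewrite [RHS]big_mkcond /=; apply: eq_bigr => m _.
rewrite mul_mx_diag !mxE; have [|] := leqP (maxn j k) m; last first.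
  rewrite ltnNge geq_max negb_and -!ltnNge => /orP[] /coef_qdpoly_gt ->.
    by rewrite !mul0r.
  by rewrite !mul0r mulr0.
rewrite geq_max => /andP[jm km].
rewrite !coef_qdpoly // /qpochs !big_cons !big_nil !mulr1 !addn1.
have eA i : (i <= m)%N ->
    qpoch (a * q ^+ i.+1) q (m - i) = qpoch (a * q) q m / qpoch (a * q) q i.
  move=> im; rewrite -[in RHS](subnKC im) qpochD exprS (mulrA a).
  by rewrite [RHS]mulrAC divff ?mul1r.
have h1 : 1 - a * b * q != 0 by have := hd 0%N; rewrite expr1.
have h2 := hd (2 * m)%N.
have epiv : pivot m = a ^+ m * q ^+ (m ^ 2) * qpoch q q m * qpoch (a * q) q m
    * qpoch (b * q) q m * (1 - a * b * q)
    / (qpoch (a * b * q) q m * (1 - a * b * q ^+ (2 * m).+1)).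
  have e : qpoch (a * b * q) q m * qpoch (a * b * q ^+ m.+1) q m
      * (1 - a * b * q ^+ (2 * m).+1)
      = (1 - a * b * q) * qpoch (a * b * q ^+ 2) q (2 * m).
    rewrite exprS expr2 !mulrA -qpochD -qpochSl addnn -mul2n qpochS.
    by rewrite (exprS q (2 * m)) !mulrA.
  have h3 := hab 1%N (2 * m)%N.
  apply: (mulIf h3); rewrite /pivot divfK //.
  apply: (mulfI (hab1 m)); apply: (mulIf h2).
  transitivity (a ^+ m * q ^+ (m ^ 2) * qpoch q q m * qpoch (a * q) q m
    * qpoch (b * q) q m * (qpoch (a * b * q) q m * qpoch (a * b * q ^+ m.+1) q m
      * (1 - a * b * q ^+ (2 * m).+1))); first by ring.
  by rewrite e; field; rewrite hab1 h2.
have eexp : q ^+ 'C(m - j, 2) * q ^+ 'C(m - k, 2)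
    = q ^+ ((j * j.+1 + k * k.+1) %/ 2) * q ^+ (m ^ 2) / q ^+ ((j + k).+1 * m).
  apply: (canRL (mulfK _)); first by rewrite expf_neq0.
  rewrite -!exprD; congr (_ ^+ _).
  have -> : (j * j.+1 + k * k.+1 = ('C(j.+1, 2) + 'C(k.+1, 2)) * 2)%N.
    have := mul_bin_diag j.+1 1; have := mul_bin_diag k.+1 1.
    by rewrite !bin1 /=; nia.
  rewrite mulnK //.
  have ebin i : (i <= m)%N ->
      ('C(m - i, 2) + m * i + m = 'C(i.+1, 2) + 'C(m.+1, 2))%N.
    move=> im; rewrite -(subnKC im) addKn; move: (m - i)%N => d.
    have := mul_bin_diag d 1; have := mul_bin_diag i.+1 1.
    have := mul_bin_diag (i + d).+1 1.
    by rewrite !bin1 /=; case: d => [|d] /=; nia.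
  have := ebin j jm; have := ebin k km; have := mul_bin_diag m.+1 1.
  by rewrite bin1 /=; nia.
rewrite epiv !eA // exprMn -exprM exprD.
transitivity ((-1) ^+ j * (-1) ^+ k * (q ^+ 'C(m - j, 2) * q ^+ 'C(m - k, 2))
  * qbinom q m j * qbinom q m k
  * qpoch (a * b * q ^+ m.+1) q j * qpoch (a * b * q ^+ m.+1) q k
  * (qpoch (a * q) q m / qpoch (a * q) q j) * (qpoch (a * q) q m / qpoch (a * q) q k)
  * (qpoch (a * b * q) q m * (1 - a * b * q ^+ (2 * m).+1))
  / (a ^+ m * q ^+ (m ^ 2) * qpoch q q m * qpoch (a * q) q m
     * qpoch (b * q) q m * (1 - a * b * q))).
  by field; rewrite ?h1 ?h2 ?hq ?haq ?hbq ?hab1 ?expf_neq0.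
rewrite eexp.
by field; rewrite ?h1 ?h2 ?hq ?haq ?hbq ?hab1 ?expf_neq0.
Qed.
End Hankel.

Theorem theorem2p1 (R : realType) (n : nat) (a b q : R[i]) :
  ((forall j k : 'I_n.+1, qpoch (a * b * q ^+ 2) q (j + k) != 0) ->
   (forall k : nat, (1 <= k <= n)%N ->
      qpochs [:: a * b * q; a * b * q ^+ 2; a * b * q ^+ 2; a * b * q ^+ 3]
        (q ^+ 2) k != 0) ->
   \det (qjacobi_hankel n a b q) =
     a ^+ ((n * (n + 1)) %/ 2) * q ^+ ((n * (n + 1) * (2 * n + 1)) %/ 6)
     * \prod_(1 <= k < n.+1)
         (qpochs [:: q; a * q; b * q; a * b * q] q k
          / qpochs [:: a * b * q; a * b * q ^+ 2; a * b * q ^+ 2;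
                       a * b * q ^+ 3] (q ^+ 2) k))
  /\
  (a != 0 -> q != 0 ->
   (forall k : nat, (1 <= k)%N ->
      [/\ q ^+ k != 1, a * q ^+ k != 1, b * q ^+ k != 1
        & a * b * q ^+ k != 1]) ->
   qjacobi_hankel n a b q \in unitmx /\
   invmx (qjacobi_hankel n a b q) = qjacobi_hankel_inv n a b q).
Proof.
split=> [hH hd|]; last exact: invmx_qjacobi_hankelE.
case: n => [|n] in hH hd *.
  (* Here 1 - abq may vanish; the matrix is reduced to the entry 1. *)
  rewrite det_mx11 mxE !qpoch0 divr1 big_geq // !mul0n !div0n !expr0.
  by rewrite !mulr1.
apply: det_qjacobi_hankelE => -[_|i im].
  have := hd 1%N isT; rewrite /qpochs big_cons mulf_eq0 negb_or => /andP[h _].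
  have := qpoch_neq0P h (ltnSn 0).
  by rewrite expr0 expr1 mulr1.
have i2n : (i < n.+1 + n.+1)%N by lia.
have := qpoch_neq0P (hH ord_max ord_max) i2n.
by rewrite -(mulrA (a * b)) -exprD.
Qed.
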